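(* Let $n,k\in\mathbb{N}$ with $k\ge 2$ and $n\ge 3k+2$. Then the pendant path graph $P_n^*$ does not have the $(n-k)$-EKR property.
   Context: All graphs are finite and simple. For a graph $G$ and $r\in\mathbb{N}$, $\mathcal{I}^{(r)}(G)$ denotes the family of independent $r$-subsets of $V(G)$. A subfamily $\mathcal{A}\subseteq\mathcal{I}^{(r)}(G)$ is intersecting if every two members have nonempty intersection. For $v\in V(G)$, the $r$-star centered at $v$ is $\{A\in\mathcal{I}^{(r)}(G): v\in A\}$. A graph $G$ has the $r$-EKR property (is $r$-EKR) if every largest intersecting subfamily of $\mathcal{I}^{(r)}(G)$ is an $r$-star, i.e., all its members contain a common vertex. The pendant path graph $P_n^*$ has vertices $x_1,\dots,x_n,p_1,\dots,p_n$ and edges $x_ix_{i+1}$ for $1\le i\le n-1$ together with $x_ip_i$ for $1\le i\le n$. *)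

(* Defs.v *)
From mathcomp Require Import all_boot.

Set Implicit Arguments.
Unset Strict Implicit.
Unset Printing Implicit Defensive.

Record sgraph := SGraph {
  vertex : finType;
  adj : rel vertex;
  adj_sym : symmetric adj;
  adj_irr : irreflexive adj
}.

Definition independent (G : sgraph) (A : {set vertex G}) : bool :=
  [forall x in A, forall y in A, ~~ adj x y].

Definition indep_sets (r : nat) (G : sgraph) : {set {set vertex G}} :=
  [set A : {set vertex G} | (#|A| == r) && independent A].

Definition intersecting (T : finType) (F : {set {set T}}) : Prop :=
  forall A B : {set T}, A \in F -> B \in F -> A :&: B != set0.

Definition star (r : nat) (G : sgraph) (v : vertex G) : {set {set vertex G}} :=
  [set A in indep_sets r G | v \in A].

Definition largest_intersecting (r : nat) (G : sgraph)
    (F : {set {set vertex G}}) : Prop :=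
  [/\ F \subset indep_sets r G,
      intersecting F &
      forall F' : {set {set vertex G}},
        F' \subset indep_sets r G -> intersecting F' -> #|F'| <= #|F|].

(* This is the strict form of the property: every largest intersecting family
   is a star, not merely some largest one. *)
Definition EKR (r : nat) (G : sgraph) : Prop :=
  forall F : {set {set vertex G}},
    largest_intersecting r F -> exists v : vertex G, F = star r v.

(* [inl i] is the path vertex x_(i+1) and [inr i] its pendant p_(i+1). *)
Definition pendant_path_adj (n : nat) : rel ('I_n + 'I_n) :=
  fun u v =>
    match u, v with
    | inl i, inl j => (i.+1 == j :> nat) || (j.+1 == i :> nat)
    | inl i, inr j | inr i, inl j => i == j
    | inr _, inr _ => false
    end.

Lemma pendant_path_adj_sym n : symmetric (@pendant_path_adj n).
Proof. by case=> i [] j //=; rewrite 1?orbC 1?eq_sym. Qed.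

Lemma pendant_path_adj_irr n : irreflexive (@pendant_path_adj n).
Proof. by case=> i //=; rewrite orbb (gtn_eqF (ltnSn i)). Qed.

Definition pendant_path (n : nat) : sgraph :=
  SGraph (@pendant_path_adj_sym n) (@pendant_path_adj_irr n).

(* Main.v *)
(** No star is a largest intersecting family, because some [(n-k)]-set [B]
    avoids its centre and meets every independent [(n-k)]-set. [B] consists of
    the pendants outside a block of [k] consecutive indices containing the index
    of the centre. An independent set disjoint from [B] has at most one vertex
    per index of the block, and only pairwise nonadjacent path vertices outside
    it. Since [k >= 2], the block can be placed so that the two segments around
    it do not both have odd length, which bounds such a set by
    [uphalf (n-k) + k]; this is less than [n-k] once [n >= 3k+2]. *)

Require Import Defs.
From mathcomp Require Import all_boot zify.

Set Implicit Arguments.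
Unset Strict Implicit.
Unset Printing Implicit Defensive.

Lemma independentP (G : sgraph) (A : {set vertex G}) :
  reflect {in A &, forall x y, ~~ adj x y} (independent A).
Proof.
apply: (iffP forall_inP) => [indA x y xA yA | indA x xA].
  by have /forall_inP := indA x xA; apply.
by apply/forall_inP => y yA; apply: indA.
Qed.

(** [EKR] quantifies over largest families, so refuting it requires one to exist. The empty family
    is a candidate and there are finitely many. *)
Lemma largest_intersecting_exists (r : nat) (G : sgraph) :
  exists F : {set {set vertex G}}, largest_intersecting r F.
Proof.
pose isectb (F : {set {set vertex G}}) :=
  [forall A in F, forall B in F, A :&: B != set0].
have isectP F : reflect (intersecting F) (isectb F).
  apply: (iffP forall_inP) => [isF A B FA FB | isF A FA].
    by have /forall_inP := isF A FA; apply.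
  by apply/forall_inP => B FB; apply: isF.
pose P (F : {set {set vertex G}}) := (F \subset indep_sets r G) && isectb F.
have P0 : P set0 by rewrite /P sub0set; apply/isectP => A B; rewrite inE.
case: (arg_maxnP (fun F : {set {set vertex G}} => #|F|) P0) => F /andP[sF /isectP iF] maxF.
exists F; split=> // F' sF' /isectP iF'.
by apply: maxF; rewrite /P sF'.
Qed.

(** Adding [B] to the star keeps it intersecting and enlarges it by one. *)
Lemma star_not_largest (r : nat) (G : sgraph) (v : vertex G)
    (B : {set vertex G}) :
  B \in indep_sets r G -> v \notin B ->
  {in indep_sets r G, forall A, A :&: B != set0} ->
  ~ largest_intersecting r (star r v).
Proof.
move=> indB vB meetB [sub_star _ max_star].
have sub_BF : B |: star r v \subset indep_sets r G.
  by rewrite subUset sub1set indB.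
have star_ind A : A \in star r v -> A \in indep_sets r G.
  exact: (subsetP sub_star).
suff /(max_star _ sub_BF) : intersecting (B |: star r v).
  by rewrite cardsU1 inE (negPf vB) andbF ltnn.
move=> A C /setU1P[-> | starA] /setU1P[-> | starC].
- exact: meetB.
- by rewrite setIC meetB ?star_ind.
- by rewrite meetB ?star_ind.
- apply/set0Pn; exists v.
  by move: starA starC; rewrite !inE => /andP[_ ->] /andP[_ ->].
Qed.

Lemma skip_block_subproof n k l (j : 'I_(n - k)) :
  (if j < l then j : nat else j + k) < n.
Proof. by have := ltn_ord j; case: ifP; lia. Qed.

Definition skip_block n k l (j : 'I_(n - k)) : 'I_n :=
  Ordinal (skip_block_subproof l j).

Lemma skip_block_inj n k l : injective (@skip_block n k l).
Proof.
move=> i j /(congr1 val) /= eq_ij; apply: val_inj => /=.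
by move: eq_ij; do ?case: ifP; lia.
Qed.

(** Encoded as the image of an injection from ['I_(n - k)], which gives the cardinality at once. *)
Definition pendants_off_block n k l : {set vertex (pendant_path n)} :=
  [set inr (skip_block l j) | j : 'I_(n - k)].

Lemma mem_pendants_off_block n k l (i : 'I_n) :
  l <= n - k -> k <= n ->
  (inr i \in pendants_off_block n k l) = (i < l) || (l + k <= i).
Proof.
move=> le_l le_k; apply/imsetP/idP => [[j _ [->]] | off_i].
  by rewrite /=; case: ifP; lia.
have lt_i := ltn_ord i.
(* The preimage under [skip_block]: indices past the block shift back by [k]. *)
have lt_j : (if i < l then i : nat else i - k) < n - k by case: ifP; lia.
exists (Ordinal lt_j) => //; congr inr; apply: val_inj => /=.
by case: (ltnP i l) off_i => /= h; [rewrite h | case: ifP; lia].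
Qed.

Lemma pendants_off_block_notin_inl n k l (i : 'I_n) :
  inl i \notin pendants_off_block n k l.
Proof. by apply/imsetP => -[]. Qed.

Lemma pendants_off_block_indep n k l :
  pendants_off_block n k l \in indep_sets (n - k) (pendant_path n).
Proof.
rewrite inE card_imset ?card_ord ?eqxx /=; last first.
  by move=> i j [eq_ij]; apply/(@skip_block_inj _ _ l)/val_inj.
by apply/independentP => _ _ /imsetP[i _ ->] /imsetP[j _ ->].
Qed.

Definition index_of n (u : 'I_n + 'I_n) : 'I_n :=
  match u with inl i => i | inr i => i end.

(** Distinct vertices with the same index are a path vertex and its own pendant, which are
    adjacent. *)
Lemma index_of_inj_indep n (A : {set vertex (pendant_path n)}) :
  independent A -> {in A &, injective (@index_of n)}.
Proof.
move=> /independentP indA [] i [] j Ai Aj /= eq_ij; rewrite eq_ij //.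
- by have := indA _ _ Ai Aj; rewrite /= eq_ij eqxx.
- by have := indA _ _ Ai Aj; rewrite /= eq_ij eqxx.
Qed.

(* Indices off the block are renumbered consecutively and paired up; the parity
   condition makes every pair consist of neighbours in the path. *)
Lemma card_indep_disjoint_pendants n k l (A : {set vertex (pendant_path n)}) :
  k <= n -> l <= n - k -> ~~ odd l || (l == n - k) -> independent A ->
  A :&: pendants_off_block n k l = set0 -> #|A| <= uphalf (n - k) + k.
Proof.
move=> le_k le_l parity indA disjAB.
have offA (u : vertex (pendant_path n)) : u \in A ->
    (index_of u < l) || (l + k <= index_of u) -> u = inl (index_of u).
  case: u => i // Ai /= off_i.
  have : inr i \in A :&: pendants_off_block n k l.
    by rewrite inE Ai mem_pendants_off_block.
  by rewrite disjAB inE.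
(* Pairs off the block take the first [uphalf (n - k)] slots; each block index then gets a slot of
   its own. *)
pose slot i := if i < l then i./2 else
               if l + k <= i then (i - k)./2 else uphalf (n - k) + (i - l).
have slotP (u : vertex (pendant_path n)) :
    slot (index_of u) < uphalf (n - k) + k.
  by have := ltn_ord (index_of u); rewrite /slot; do ?case: ifP; lia.
pose f (u : vertex (pendant_path n)) := Ordinal (slotP u).
have f_inj : {in A &, injective f}.
  move=> u v Au Av /(congr1 val) /= eq_slot.
  apply: (index_of_inj_indep indA) => //; apply: val_inj => /=.
  have := ltn_ord (index_of u); have := ltn_ord (index_of v).
  have := offA u Au; have := offA v Av; move: eq_slot.
  have /independentP/(_ u v Au Av) := indA.
  move: (index_of u) (index_of v) => i j adj_uv eq_slot off_j off_i lt_j lt_i.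
  have nadj : (i < l) || (l + k <= i) -> (j < l) || (l + k <= j) ->
      (i.+1 != j) && (j.+1 != i).
    move=> /off_i eq_u /off_j eq_v.
    by move: adj_uv; rewrite eq_u eq_v /= negb_or.
  (* No pair straddles the block: either [l] is even, or [l = n - k] and no index follows the
     block. *)
  by move: eq_slot nadj parity; rewrite /slot; do ?case: ifP => /=; lia.
by rewrite -(card_in_imset f_inj) -[leqRHS]card_ord max_card.
Qed.

Theorem theorem6 (n k : nat) (hk : 2 <= k) (hn : 3 * k + 2 <= n) :
  ~ EKR (n - k) (pendant_path n).
Proof.
move=> ekr.
have [F largestF] := largest_intersecting_exists (n - k) (pendant_path n).
have [v defF] := ekr F largestF.
pose i : 'I_n := index_of v.
(* Rounding [i] down to an even number gives [l <= i <= l + 1 < l + k], as [k >= 2]. The cap makes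
   the block end at [n] if it would overrun. *)
pose l := minn (i./2).*2 (n - k).
have le_l : l <= n - k by rewrite geq_minr.
have le_k : k <= n by lia.
have parity : ~~ odd l || (l == n - k) by rewrite /l; lia.
have lt_i : i < n := ltn_ord i.
have block_i : l <= i < l + k by rewrite /l; lia.
rewrite defF in largestF.
apply: (star_not_largest (pendants_off_block_indep n k l) _ _ largestF).
- case: v @i @l le_l parity lt_i block_i {defF largestF} => j /= *.
    exact: pendants_off_block_notin_inl.
  by rewrite mem_pendants_off_block //; lia.
- move=> A; rewrite inE => /andP[/eqP cardA indA]; apply/eqP => disjAB.
  have := card_indep_disjoint_pendants le_k le_l parity indA disjAB.
  (* The bound would give [(n - k)./2 <= k], but [n - k >= 2 * k + 2]. *)
  by rewrite cardA; lia.
Qed.
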